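(* Let $S$ be a numerical semigroup with multiplicity $m$ and Kunz coordinates $(k_1,\dots,k_{m-1})$. Then $$|\mathcal{I}_0(S)|\le\prod_{i=1}^{m-1}(k_i+1).$$ Equality holds if and only if $S=\langle m\rangle\cup(c+\mathbb{N})$ for some positive integer $c$ greater than $m$; equivalently, equality holds if and only if both (1) $k_1\ge\dots\ge k_{m-1}$, and (2) $k_1-k_{m-1}\le 1$.
   Context: $\mathbb{N}$ denotes the non-negative integers. A numerical semigroup $S$ is a submonoid of $(\mathbb{N},+)$ with finite complement in $\mathbb{N}$. The multiplicity $m$ of $S$ is its smallest positive element. $\langle m\rangle=\{km:k\in\mathbb{N}\}$. The Kunz coordinates of $S$ are the integers $k_1,\dots,k_{m-1}$ such that $k_im+i$ is the least element of $S$ congruent to $i$ modulo $m$, for $i\in\{1,\dots,m-1\}$. (If $m=1$, the list is empty, the product is $1$, and conditions (1) and (2) are vacuous.) $\mathcal{I}_0(S)=\{E\subseteq\mathbb{N}: E+S\subseteq E,\ \min(E)=0\}$ is the set of ideals of $S$ with minimum $0$. *)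

(* Defs.v *)
From mathcomp Require Import all_boot.
From mathcomp Require Import boolp classical_sets functions cardinality.

Set Implicit Arguments.
Unset Strict Implicit.
Unset Printing Implicit Defensive.

Local Open Scope classical_set_scope.
Local Open Scope nat_scope.

Definition numerical_semigroup (S : set nat) : Prop :=
  [/\ S 0, forall x y, S x -> S y -> S (x + y) & finite_set (~` S)].

Definition is_min (A : set nat) (n : nat) : Prop :=
  A n /\ forall x, A x -> n <= x.

Definition is_multiplicity (S : set nat) (m : nat) : Prop :=
  is_min [set x | S x /\ 0 < x] m.

(* Only the values k 1, ..., k (m - 1) are constrained (and used). Since the
   least element k_i m + i is nonnegative and i < m, the integer k_i is
   nonnegative, so that natural-valued k loses nothing. *)
Definition is_kunz_coordinates (S : set nat) (m : nat) (k : nat -> nat) : Prop :=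
  forall i, 0 < i < m -> is_min [set x | S x /\ x = i %[mod m]] (k i * m + i).

Definition ideals0 (S : set nat) : set (set nat) :=
  [set E | [set x + s | x in E & s in S] `<=` E /\ is_min E 0].

(* Main.v *)
(* An ideal E with minimum 0 is determined by the numbers e_0 = 0, e_1, ...,
   e_(m-1), where e_i m + i is the least element of E congruent to i modulo m.
   As 0 lies in E, E contains S, so that e_i <= k_i; this gives the bound, with
   equality iff every e in the box is realised by an ideal. Testing the tuples
   e that vanish outside one residue r, where e_r = k_r, this forces
   k_r <= k_j for j < r and k_r <= k_j + 1 for r < j; conversely these
   inequalities make every e in the box an ideal. They say that k is
   nonincreasing with values in {K, K + 1}, i.e. that S is <m> together with
   all integers >= K m + t, where t is the first index with k_t = K. *)
Require Import Defs.
From mathcomp Require Import all_boot.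
From mathcomp Require Import boolp classical_sets functions cardinality.
From mathcomp Require Import zify.

Local Open Scope classical_set_scope.
Local Open Scope card_scope.
Local Open Scope nat_scope.

(** For values of [e] on residues below [m], this is the set closed under adding [m] whose least
    element in the class of [r] is [e r * m + r]. *)
Definition above (m : nat) (e : nat -> nat) : set nat :=
  [set x | e (x %% m) <= x %/ m].

Lemma aboveE m e q r : r < m -> above m e (q * m + r) = (e r <= q) :> Prop.
Proof.
move=> rm; rewrite /above /= modnMDl modn_small// divnMDl ?divn_small ?addn0//.
by lia.
Qed.

Lemma above_of_min (m : nat) (E : set nat) (e : nat -> nat) : 0 < m ->
  (forall x, E x -> E (x + m)) ->
  (forall r, r < m -> is_min [set q | E (q * m + r)] (e r)) -> E = above m e.
Proof.
move=> m0 Em emin; apply/funext => x; apply/propext.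
rewrite (divn_eq x m) aboveE ?ltn_mod//.
have [/= Er ler] := emin _ (ltn_pmod x m0); split; first exact: ler.
move=> /subnK <-; elim: (_ - _) => [|d IHd] //.
by rewrite addSn mulSnr addnAC; apply: Em.
Qed.

Definition extend0 (k : nat -> nat) (r : nat) : nat := if r == 0 then 0 else k r.

Lemma semigroup_above {S m k} : numerical_semigroup S -> is_multiplicity S m ->
  is_kunz_coordinates S m k -> S = above m (extend0 k).
Proof.
move=> [S0 SD _] [[/= Sm m0] _] hk; apply: above_of_min => //.
  by move=> x Sx; apply: SD.
move=> [|r] rm; first by split=> //=; rewrite mul0n.
have [/= [Sr _] ler] := hk r.+1 rm; split=> // q /= Sq.
have /ler : S (q * m + r.+1) /\ q * m + r.+1 = r.+1 %[mod m].
  by rewrite modnMDl.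
by rewrite leq_add2r leq_pmul2r.
Qed.

(** Here [n.+1] is the multiplicity and index [i] stands for the residue [i.+1]; the class of 0
    carries no freedom. *)
Definition box (n : nat) (k : nat -> nat) :=
  {dffun forall i : 'I_n, 'I_(k i.+1).+1}.

Definition coord {n k} (t : box n k) (r : nat) : nat :=
  if r is r'.+1 then oapp (fun i : 'I_n => t i : nat) 0 (insub r') else 0.

Definition box_of (n : nat) (k e : nat -> nat) : box n k :=
  [ffun i : 'I_n => inord (e i.+1) : 'I_(k i.+1).+1].

Lemma coord_ord n k (t : box n k) (i : 'I_n) : coord t i.+1 = t i.
Proof. by rewrite /coord valK. Qed.

Lemma coord_le n k (t : box n k) r : coord t r <= extend0 k r.
Proof.
case: r => [|r] //=; rewrite /extend0 /=.
by case: insubP => //= i _ <-; rewrite -ltnS.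
Qed.

Lemma box_ofK n k e r : (forall r, e r <= extend0 k r) -> r <= n ->
  coord (box_of n k e) r = e r.
Proof.
case: r => [|r] ek rn; first by have := ek 0; rewrite /extend0/=; lia.
by rewrite -[r]/(val (Ordinal rn)) coord_ord ffunE inordK// ltnS ek.
Qed.

Lemma card_box n k : #|{: box n k}| = \prod_(1 <= i < n.+1) (k i + 1).
Proof.
rewrite card_dep_ffun foldrE big_map big_enum/= big_add1 big_mkord.
by apply: eq_bigr => i _; rewrite card_ord addn1.
Qed.

(** Each [t i] is recovered as the threshold for the quotients [q] at which the class of [i.+1]
    meets the set. *)
Lemma above_coord_inj n k : injective (fun t : box n k => above n.+1 (coord t)).
Proof.
move=> t u tu; apply/ffunP => i; apply/val_inj => /=.
have tuE q : (t i <= q) = (u i <= q).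
  have := congr1 (fun E => E (q * n.+1 + i.+1)) tu.
  rewrite /= !aboveE ?ltnS// !coord_ord => eq_tu.
  by apply/idP/idP; rewrite eq_tu.
by apply/eqP; rewrite eqn_leq -tuE leqnn tuE leqnn.
Qed.

Lemma above_ext m e f : 0 < m -> (forall r, r < m -> e r = f r) ->
  above m e = above m f.
Proof.
by move=> m0 ef; apply/funext => x; rewrite /above/= ef// ltn_mod.
Qed.

Lemma ideal_is_above {S n k E} : numerical_semigroup S -> is_multiplicity S n.+1 ->
  is_kunz_coordinates S n.+1 k -> ideals0 S E ->
  exists t : box n k, E = above n.+1 (coord t).
Proof.
move=> hS hm hk [ES [E0 _]]; have Sabove := semigroup_above hS hm hk.
have Sm : S n.+1 by case: hm => -[].
have ED x s : E x -> S s -> E (x + s).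
  by move=> Ex Ss; apply: ES; exists x => //; exists s.
have Ek r : r < n.+1 -> `[< E (extend0 k r * n.+1 + r) >].
  by move=> rm; apply/asboolP/(ED 0) => //; rewrite Sabove aboveE.
(* The disjunct [n < r] makes the search total and gives [e] the value 0 beyond the residues. *)
have ex r : exists q, (n < r) || `[< E (q * n.+1 + r) >].
  by exists (extend0 k r); case: ltnP => //= rn; apply: Ek.
pose e r := ex_minn (ex r).
have emin r : r < n.+1 -> is_min [set q | E (q * n.+1 + r)] (e r).
  rewrite /e => rn; case: ex_minnP => q /orP[|/asboolP Eq leqE]; first by lia.
  by split=> // p /= Ep; apply: leqE; apply/orP; right; apply/asboolP.
have ek r : e r <= extend0 k r.
  by rewrite /e; case: ex_minnP => q _; apply; case: ltnP => //= rn; apply: Ek.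
exists (box_of n k e); rewrite (@above_of_min n.+1 E e)//.
  by apply: above_ext => // r rn; rewrite box_ofK.
by move=> x Ex; apply: ED.
Qed.

(** Through [f], [D] is equipotent to a subset [A] of [F]; by finiteness, [A] has full cardinality
    only if it is all of [F]. *)
Lemma card_le_eq_finType {T : Type} {F : finType} {D : set T} {f : F -> T} :
  injective f -> D `<=` range f ->
  D #<= `I_#|F| /\ (D #= `I_#|F| <-> forall t, D (f t)).
Proof.
move=> finj Df; pose A : {pred F} := [pred t | `[< D (f t) >]].
have DA : D #= `I_#|A|.
  have -> : D = [set f (enum_val i) | i in [set: 'I_#|A|]].
    apply/seteqP; split=> [x Dx|_ [i _ <-]]; last by have /asboolP := enum_valP i.
    have [t _ ftx] := Df _ Dx.
    have At : t \in A by apply/asboolP; rewrite ftx.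
    by exists (enum_rank_in At t); rewrite // enum_rankK_in.
  apply: card_eq_trans (inj_card_eq _) (card_esym card_II).
  by move=> i j _ _ /finj/enum_val_inj.
split.
  by rewrite (card_le_eql DA) card_le_II max_card.
rewrite (card_eql DA); split=> [/card_eq_II cA t|Dall].
  have AT : A =i predT by apply/subset_cardP => //; apply: subset_predT.
  by have := AT t; rewrite !inE => /asboolP.
apply/card_eq_II; apply: eq_card => t; rewrite !inE.
exact/asboolP.
Qed.

Lemma box_ideals_iff {S n k} : numerical_semigroup S -> is_multiplicity S n.+1 ->
  is_kunz_coordinates S n.+1 k ->
  (forall t : box n k, ideals0 S (above n.+1 (coord t))) <->
  (forall r j, 0 < r <= n -> 0 < j <= n ->
    (j <= r -> k r <= k j) /\ (r <= j -> k r <= k j + 1)).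
Proof.
move=> hS hm hk; have Sabove := semigroup_above hS hm hk.
split=> [idl r j rn jn|kP t]; last first.
  split; last by split; rewrite // /above/= mod0n.
  move=> _ [x Ex [s + <-]]; rewrite Sabove.
  move: Ex; rewrite (divn_eq x n.+1) (divn_eq s n.+1).
  move: (x %/ _) (s %/ _) (ltn_pmod x (ltn0Sn n)) (ltn_pmod s (ltn0Sn n)).
  move: (x %% _) (s %% _) => {x s} i j q p; rewrite !ltnS => lin ljn.
  rewrite !aboveE ?ltnS//= => tq kp; rewrite addnACA -mulnDl.
  case: (posnP j) => [->|j0]; first by rewrite addn0 aboveE// ; lia.
  have {}kp : k j <= p by move: kp; rewrite /extend0; case: eqP => // j0'; lia.
  have [ijn|ijn] := leqP (i + j) n.
    rewrite aboveE//; apply: leq_trans (coord_le _ _ _ _) _.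
    rewrite /extend0 ifF; last by lia.
    by have [|| h _] := kP (i + j) j; lia.
  (* The residues wrap around; the carry raises the quotient by one, which pays for the [+ 1] in the
     second inequality. *)
  have -> : i + j = n.+1 + (i + j - n.+1) by lia.
  rewrite addnA -mulSnr aboveE; last by lia.
  apply: leq_trans (coord_le _ _ _ _) _; rewrite /extend0; case: eqP => // r0.
  by have [|| _ h] := kP (i + j - n.+1) j; lia.
pose e i := if i == r then k r else 0.
have ek i : e i <= extend0 k i.
  by rewrite /e /extend0; case: eqP => // ->; case: eqP => //; lia.
have := idl (box_of n k e); rewrite (@above_ext _ _ e) => [|//|i]; last first.
  by rewrite ltnS => ?; apply: box_ofK.
case=> [ED _].
(* As [e i = 0], [i] itself lies in the ideal; it is shifted by the least element of [S] in the
   class of [j]. Below, [i] is chosen so that the sum falls in the class of [r], first without and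
   then with a carry. *)
have step i : i <= n -> i <> r -> above n.+1 e (i + (k j * n.+1 + j)).
  move=> lin ir; apply: ED; exists i.
    by rewrite -[i]add0n -(mul0n n.+1) aboveE// /e; case: eqP.
  by exists (k j * n.+1 + j) => //; rewrite Sabove aboveE ?/extend0 ?ifF//; lia.
split=> rj.
  have [->//|jr] := eqVneq r j.
  have := step (r - j); have -> : r - j + (k j * n.+1 + j) = k j * n.+1 + r by lia.
  by rewrite aboveE ?/e ?eqxx; lia.
have [->|jr] := eqVneq r j; first by lia.
have := step (n.+1 + r - j).
have -> : n.+1 + r - j + (k j * n.+1 + j) = (k j).+1 * n.+1 + r by lia.
by rewrite aboveE ?/e ?eqxx; lia.
Qed.

Lemma almost_constant_iff n k :
  (forall r j, 0 < r <= n -> 0 < j <= n ->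
    (j <= r -> k r <= k j) /\ (r <= j -> k r <= k j + 1)) <->
  (forall i, 0 < i -> i + 1 < n.+1 -> k (i + 1) <= k i) /\
  (1 < n.+1 -> k 1 - k (n.+1 - 1) <= 1).
Proof.
split=> [kP|[kdec kd]].
  split=> [i i0 im|n0]; first by have [||h _] := kP (i + 1) i; lia.
  by have [||_ h] := kP 1 n; rewrite ?subn1/=; lia.
have kle j d : 0 < j -> j + d <= n -> k (j + d) <= k j.
  move=> j0; elim: d => [|d IHd] jd; first by rewrite addn0.
  by have := kdec (j + d); rewrite -addnA addn1; lia.
move=> r j rn jn; split=> rj.
  by have := kle j (r - j); rewrite subnKC//; lia.
(* The chain is [k r <= k 1 <= k n + 1 <= k j + 1]. *)
have := kle 1 (r - 1); have := kle j (n - j); move: kd.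
by rewrite !subnKC ?subn1/=; lia.
Qed.

Lemma semigroup_interval_iff {S n k} : numerical_semigroup S -> is_multiplicity S n.+1 ->
  is_kunz_coordinates S n.+1 k ->
  (exists2 c, n.+1 < c & S = [set j * n.+1 | j in setT] `|` [set c + i | i in setT]) <->
  (forall r j, 0 < r <= n -> 0 < j <= n ->
    (j <= r -> k r <= k j) /\ (r <= j -> k r <= k j + 1)).
Proof.
move=> hS hm hk; have Sabove := semigroup_above hS hm hk.
have Sk r q : 0 < r <= n -> S (q * n.+1 + r) = (k r <= q) :> Prop.
  by move=> rn; rewrite Sabove aboveE ?/extend0 ?ifF//; lia.
split=> [[c _ Sc]|kP].
  (* Off the multiples of [n.+1], [c] alone decides membership, so both inequalities come from
     comparing positions in the classes of [r] and [j]. *)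
  have kc r q : 0 < r <= n -> (k r <= q) = (c <= q * n.+1 + r).
    move=> rn; apply/idP/idP; rewrite -Sk// Sc.
      case=> [[p _ pE]|[i _ <-]]; last by lia.
      have := congr1 (modn^~ n.+1) pE.
      by rewrite modnMl modnMDl modn_small; lia.
    by move=> /subnKC <-; right; exists (q * n.+1 + r - c).
  move=> r j rn jn; have := kc j (k j) jn; rewrite leqnn => /esym cj.
  by split=> rj; rewrite kc//; nia.
have [n_eq0|n0] := posnP n.
  (* Multiplicity 1 means that [S] is everything, and any [c] above 1 would do. *)
  subst n; exists 2 => //; apply/seteqP; split=> x _; first by left; exists x; rewrite ?muln1.
  by rewrite Sabove /above/= modn1 /extend0.
have ext : exists t, (0 < t <= n) && (k t <= k n) by exists n; rewrite n0 !leqnn.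
case: (ex_minnP ext) => t /andP[tn ktn] tmin; exists (k n * n.+1 + t).
  (* If [k n] were 0, [n] would be a positive element of [S] below the multiplicity. *)
  suff : 0 < k n by nia.
  rewrite lt0n; apply/eqP => kn0.
  have Sn : S n by rewrite -[n]add0n -(mul0n n.+1) Sk ?kn0//; lia.
  by have [_ /(_ n)] := hm; rewrite /= ltnn => /(_ (conj Sn n0)).
apply/funext => x; apply/propext; rewrite (divn_eq x n.+1).
move: (x %/ _) (x %% _) (ltn_pmod x (ltn0Sn n)) => {x} q [|r] rn.
  rewrite addn0; split=> _; first by left; exists q.
  by rewrite -[X in S X]addn0 Sabove aboveE.
rewrite Sk//.
have [kr kr'] : (t <= r.+1 -> k r.+1 = k n) /\ (r.+1 < t -> k r.+1 = (k n).+1).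
  have [||h1 _] := kP n r.+1; [lia..|].
  have [||_ h2] := kP r.+1 n; [lia..|].
  have [||h3 _] := kP r.+1 t; [lia..|].
  by split=> rt; [lia | have := tmin r.+1; lia].
(* Comparison with [c] is lexicographic in quotient and residue: classes from [t] on start at
   quotient [k n], earlier ones at [(k n).+1]. *)
have -> : (k r.+1 <= q) = (k n * n.+1 + t <= q * n.+1 + r.+1).
  by case: (leqP t r.+1) => rt; rewrite ?(kr rt) ?(kr' rt); nia.
split=> [h|[[p _ pE]|[i _ <-]]]; last by lia.
  by right; exists (q * n.+1 + r.+1 - (k n * n.+1 + t)) => //; rewrite subnKC.
have := congr1 (modn^~ n.+1) pE.
by rewrite modnMl modnMDl modn_small.
Qed.

(* The truncated subtraction in the last condition is harmless: a negative
   difference is at most 1 as well. *)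
Theorem corollary4p5 (S : set nat) (m : nat) (k : nat -> nat)
  (hS : numerical_semigroup S) (hm : is_multiplicity S m)
  (hk : is_kunz_coordinates S m k) :
  [/\ ideals0 S #<= `I_(\prod_(1 <= i < m) (k i + 1)),
      ideals0 S #= `I_(\prod_(1 <= i < m) (k i + 1)) <->
        (exists2 c, m < c & S = [set j * m | j in setT] `|` [set c + n | n in setT])
    & ideals0 S #= `I_(\prod_(1 <= i < m) (k i + 1)) <->
        (forall i, 0 < i -> i + 1 < m -> k (i + 1) <= k i) /\
        (1 < m -> k 1 - k (m - 1) <= 1)].
Proof.
case: m hm hk => [|n] hm hk; first by case: hm => -[].
have idl_range : ideals0 S `<=` range (fun t : box n k => above n.+1 (coord t)).
  by move=> E /(ideal_is_above hS hm hk)[t ->]; exists t.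
have [] := card_le_eq_finType (@above_coord_inj n k) idl_range.
rewrite card_box => le_card eq_card.
have eq_kP := iff_trans eq_card (box_ideals_iff hS hm hk).
split=> //; apply: (iff_trans eq_kP).
  exact: iff_sym (semigroup_interval_iff hS hm hk).
exact: almost_constant_iff.
Qed.
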